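(* For integers $r\ge 2$ and $k\ge 1$, $\chi_l(K_{2r-1,r*(k-1)}^r)=k$.
   Context: All hypergraphs are finite. A vertex coloring of a hypergraph is proper if no edge is monochromatic. A $k$-list assignment $L$ assigns to each vertex $v$ a set $L(v)$ of exactly $k$ colors; an $L$-coloring is a proper coloring with each vertex $v$ colored from $L(v)$; $\chi_l(H)$ is the least $k$ such that $H$ is $L$-colorable for every $k$-list assignment $L$. For positive integers $p_1,\dots,p_k$ and disjoint sets $V_1,\dots,V_k$ with $|V_i|=p_i$, the hypergraph $K^r_{p_1,\dots,p_k}$ has vertex set $V_1\cup\cdots\cup V_k$ and edge set consisting of all $r$-subsets $S$ of the vertex set with $S\not\subseteq V_i$ for every $i$. $K_{2r-1,r*(k-1)}^r$ denotes this hypergraph with one part of size $2r-1$ and $k-1$ parts of size $r$. *)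

(* Defs.v *)
From HB Require Import structures.
From mathcomp Require Import all_boot.
From mathcomp Require Import finmap.

Set Implicit Arguments.
Unset Strict Implicit.
Unset Printing Implicit Defensive.

(* A finite hypergraph on the vertex set T is given by its edge set. *)
Definition hypergraph (T : finType) := {set {set T}}.

Section Coloring.
Variables (T : finType) (H : hypergraph T).

Definition monochromatic (C : Type) (c : T -> C) (e : {set T}) : Prop :=
  exists a : C, forall v, v \in e -> c v = a.

Definition proper_coloring (C : Type) (c : T -> C) : Prop :=
  forall e, e \in H -> ~ monochromatic c e.

Definition list_assignment (C : choiceType) (k : nat) (L : T -> {fset C}) :=
  forall v, #|` L v| = k.

Definition list_colorable (C : choiceType) (L : T -> {fset C}) : Prop :=
  exists c : T -> C, proper_coloring c /\ forall v, c v \in L v.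

(* The set C of available colors is arbitrary, possibly infinite. *)
Definition choosable (k : nat) : Prop :=
  forall (C : choiceType) (L : T -> {fset C}),
    list_assignment k L -> list_colorable L.

(* chi_l(H) = k.  This is a relation because a hypergraph with an edge of size
   at most 1 is not k-choosable for any k. *)
Definition list_chromatic_number_is (k : nat) : Prop :=
  choosable k /\ forall j, choosable j -> k <= j.

End Coloring.

Section CompleteMultipartite.
Variables (k : nat) (p : 'I_k -> nat).

(* The disjoint union of k parts, the i-th one having p i vertices. *)
Definition multipartite_vertex : finType := {i : 'I_k & 'I_(p i)}.

Definition part (i : 'I_k) : {set multipartite_vertex} :=
  [set v | tag v == i].

Definition complete_multipartite (r : nat) : hypergraph multipartite_vertex :=
  [set S : {set multipartite_vertex} |
     (#|S| == r) && [forall i, ~~ (S \subset part i)]].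

End CompleteMultipartite.

(* One part of size 2r-1 (index 0) and k-1 parts of size r. *)
Definition part_sizes (r k : nat) (i : 'I_k) : nat :=
  if val i == 0 then 2 * r - 1 else r.

(* Main.v *)
Require Import Defs.
From mathcomp Require Import all_boot.
From mathcomp Require Import finmap zify.

Set Implicit Arguments.
Unset Strict Implicit.
Unset Printing Implicit Defensive.

(** A coloring is proper iff every color class has fewer than r vertices or lies
    in one part.  For choosability, induct on k.  A color common to all lists of
    a part of size r is used on that part and deleted elsewhere.  Otherwise, by
    Hall's theorem with each color available r-1 times, one may assume that the
    set C of all colors satisfies (r-1)|C| < rk+r-1; counting incidences in a part
    of size r gives (r-1)|C| = rk+e with 0 <= e <= r-2.  Averaging over the part
    of size 2r-1 yields a color lying in at least 2r-2-e >= r of its lists.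
    Coloring all those vertices with it, Hall's condition holds for the rest. *)

(** * Hall's marriage theorem, with and without capacities *)

Section Hall.
Variables (T D : finType).
Implicit Types (L : T -> {set D}) (S U : {set T}).

Definition palette L S : {set D} := \bigcup_(v in S) L v.

Lemma palette_sup L S v : v \in S -> L v \subset palette L S.
Proof. exact: (bigcup_sup v). Qed.

Lemma paletteS L S U : S \subset U -> palette L S \subset palette L U.
Proof.
by move=> sSU; apply/bigcupsP => v vS; apply: palette_sup; apply: (subsetP sSU).
Qed.

Lemma paletteU L S U : palette L (S :|: U) = palette L S :|: palette L U.
Proof. exact: bigcup_setU. Qed.

Lemma palette_setD L S (X : {set D}) :
  palette (fun v => L v :\: X) S = palette L S :\: X.
Proof.
apply/setP=> d; rewrite inE; apply/bigcupP/andP => [[v vS]|[dX /bigcupP[v vS dv]]].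
  by rewrite inE => /andP[-> dv]; split=> //; apply/bigcupP; exists v.
by exists v => //; rewrite inE dX.
Qed.

(** Induction on [#|U|]. If some nonempty proper subset [S] is tight, match [S] first and the rest
    with colors outside its palette. Otherwise each such subset has a spare color, so any vertex may
    take any color [d] of its list and [d] may be deleted elsewhere. The color [d0] only serves for
    empty [U]. *)
Lemma hall (d0 : D) L U :
    (forall S, S \subset U -> #|S| <= #|palette L S|) ->
  exists f : T -> D, {in U, forall v, f v \in L v} /\ {in U &, injective f}.
Proof.
have [n] := ubnP #|U|; elim: n => // n IHn in L U *; rewrite ltnS => leUn hallU.
have [->|[v vU]] := set_0Vmem U.
  by exists (fun=> d0); split=> [v|v w]; rewrite inE.
have [/existsP[S /and3P[pSU S0 tight]]|/existsPn slack] := boolP [exists S : {set T},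
    [&& S \proper U, S != set0 & #|palette L S| <= #|S|]].
  have sSU := proper_sub pSU; have ltSU := proper_card pSU.
  have [||f [fL finj]] := IHn L S; first exact: leq_trans ltSU leUn.
    by move=> R sRS; apply: hallU; apply: subset_trans sRS sSU.
  have [||g [gL ginj]] := IHn (fun v => L v :\: palette L S) (U :\: S).
  - by move: S0; rewrite -card_gt0 cardsDS //; lia.
  - move=> R; rewrite subsetD palette_setD => /andP[sRU disRS].
    have := hallU (R :|: S); rewrite paletteU subUset sRU sSU => /(_ isT).
    rewrite !cardsU cardsD (disjoint_setI0 disRS) cards0.
    have := subset_leq_card (subsetIl (palette L R) (palette L S)).
    have := subset_leq_card (subsetIr (palette L R) (palette L S)).
    lia.
  have gD w : w \in U -> w \notin S -> g w \in L w :\: palette L S.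
    by move=> wU wS; apply: gL; rewrite inE wS.
  have fN w : w \in S -> f w \in palette L S.
    by move=> wS; apply: (subsetP (palette_sup L wS)); apply: fL.
  exists (fun w => if w \in S then f w else g w); split=> [w wU|w x wU xU] /=.
    by case: ifPn => [/fL //|/(gD _ wU)]; rewrite inE => /andP[].
  case: ifPn => wS; case: ifPn => xS; first exact: finj.
  - by move=> e; move: (gD _ xU xS); rewrite inE -e fN.
  - by move=> e; move: (gD _ wU wS); rewrite inE e fN.
  - by apply: ginj; rewrite inE ?wS ?xS.
have /set0Pn[d dv] : L v != set0.
  have := hallU [set v]; rewrite sub1set vU cards1 /palette big_set1 => /(_ isT).
  by rewrite card_gt0.
have [||f [fL finj]] := IHn (fun w => L w :\ d) (U :\ v).
- by rewrite (cardsD1 v U) vU in leUn.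
- move=> S sSU; have [->|S0] := eqVneq S set0; first by rewrite cards0.
  have pSU : S \proper U by apply: sub_proper_trans sSU (properD1 vU).
  have := slack S; rewrite pSU S0 /= palette_setD -ltnNge.
  by rewrite (cardsD1 d (palette L S)); case: (d \in _); lia.
exists (fun w => if w == v then d else f w); split=> [w wU|w x wU xU] /=.
  case: eqVneq => [->//|wv]; have := fL w; rewrite !inE wv wU.
  by move=> /(_ isT) /andP[].
have fd y : y \in U -> y != v -> f y != d.
  by move=> yU yv; have := fL y; rewrite !inE yv yU => /(_ isT) /andP[].
case: eqVneq => [->|wv]; case: eqVneq => [->//|xv].
- by move=> e; have := fd x xU xv; rewrite -e eqxx.
- by move=> e; have := fd w wU wv; rewrite e eqxx.
- by apply: finj; rewrite !inE ?wv ?xv.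
Qed.

End Hall.

(** Hall's theorem for [m] copies of each color: vertices that share a color receive distinct
    copies. *)
Lemma hall_capacity (T D : finType) m (d0 : D) (L : T -> {set D}) (U : {set T}) :
    0 < m -> (forall S : {set T}, S \subset U -> #|S| <= m * #|palette L S|) ->
  exists f : T -> D, {in U, forall v, f v \in L v} /\
    forall d, #|[set v in U | f v == d]| <= m.
Proof.
case: m => // m _ hallU; pose LI v := setX (L v) [set: 'I_m.+1].
have paletteI S : palette LI S = setX (palette L S) setT.
  apply/setP=> -[d i]; rewrite !inE andbT; apply/bigcupP/bigcupP => -[v vS dv];
    by exists v => //; move: dv; rewrite !inE andbT.
have [|f [fL finj]] := hall (d0, ord0) (L := LI) (U := U).
  by move=> S sSU; rewrite paletteI cardsX cardsT card_ord mulnC hallU.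
exists (fun v => (f v).1); split=> [v /fL|d]; first by rewrite !inE andbT.
rewrite -[X in _ <= X]card_ord -cardsT.
rewrite -(@card_in_imset _ _ (fun v => (f v).2) [set v in U | (f v).1 == d]).
  by rewrite subset_leq_card ?subsetT.
move=> v w; rewrite !inE => /andP[vU /eqP dv] /andP[wU /eqP dw] e.
by apply: finj => //; rewrite [LHS]surjective_pairing [RHS]surjective_pairing dv dw e.
Qed.

(** * List colorings of subsets of a partitioned vertex set *)

Section ListColoring.
Variables (T D I : finType) (pt : T -> I) (r : nat).
Implicit Types (L : T -> {set D}) (S U P X : {set T}) (J : {set I}).

Definition good U (f : T -> D) : Prop :=
  forall d, #|[set v in U | f v == d]| < r \/
    exists i, {in U, forall v, f v = d -> pt v = i}.

Definition colorable U L : Prop :=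
  exists f : T -> D, {in U, forall v, f v \in L v} /\ good U f.

Lemma colorable_hall (d0 : D) U L : 1 < r ->
    (forall S, S \subset U -> #|S| <= r.-1 * #|palette L S|) -> colorable U L.
Proof.
move=> r1 /(hall_capacity d0)[|f [fL fr]]; first by lia.
by exists f; split=> // d; left; have := fr d; lia.
Qed.

(** Colors in [X] occur only on [S] and the others only off [S], so every color class of the union
    is a class of one of the two colorings. *)
Lemma colorable_glue U S L (X : {set D}) : S \subset U ->
    colorable S (fun v => L v :&: X) -> colorable (U :\: S) (fun v => L v :\: X) ->
  colorable U L.
Proof.
move=> sSU [f [fL fgood]] [g [gL ggood]].
have fLX v : v \in S -> (f v \in L v) && (f v \in X) by move/fL; rewrite inE.
have gLX v : v \in U -> v \notin S -> (g v \in L v) && (g v \notin X).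
  by move=> vU vS; have := gL v; rewrite !inE vU vS andbC; apply.
exists (fun v => if v \in S then f v else g v); split=> [v vU|d].
  by case: ifPn => [/fLX/andP[]|/(gLX _ vU)/andP[]].
have [dX|dX] := boolP (d \in X).
- have inS v : v \in U -> (if v \in S then f v else g v) = d -> v \in S /\ f v = d.
    by move=> vU; case: ifPn => // vS e; have := gLX v vU vS; rewrite e dX andbF.
  have [ltr|[i fi]] := fgood d; last first.
    by right; exists i => v vU /(inS _ vU)[vS]; apply: fi.
  left; apply: leq_ltn_trans ltr; apply/subset_leq_card/subsetP => v.
  by rewrite !inE => /andP[vU /eqP/(inS _ vU)[-> ->]] /=.
- have inD v : v \in U -> (if v \in S then f v else g v) = d ->
      v \in U :\: S /\ g v = d.
    move=> vU; rewrite inE vU andbT; case: ifPn => // vS e.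
    by have := fLX v vS; rewrite e (negPf dX) andbF.
  have [ltr|[i gi]] := ggood d; last first.
    by right; exists i => v vU /(inD _ vU)[vS]; apply: gi.
  left; apply: leq_ltn_trans ltr; apply/subset_leq_card/subsetP => v.
  by rewrite inE => /andP[vU /eqP/(inD _ vU)[vUS gv]]; rewrite inE vUS gv /=.
Qed.

Lemma colorable_mono U L i d : U \subset pt @^-1: [set i] ->
  {in U, forall v, d \in L v} -> colorable U L.
Proof.
move=> /subsetP sU dL; exists (fun=> d); split=> // e; right; exists i => v vU _.
by have := sU v vU; rewrite !inE => /eqP.
Qed.

(* In a maximal set S violating Hall's condition keep the lists, and replace all
   other lists by a list on S; outside S, Hall's condition holds for the colors
   that do not occur on S. *)
Lemma colorable_few_colors (d0 : D) k U L : 1 < r ->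
    (forall L', {in U, forall v, k <= #|L' v|} ->
      r.-1 * #|palette L' U| < #|U| -> colorable U L') ->
  {in U, forall v, k <= #|L v|} -> colorable U L.
Proof.
move=> r1 few Lk.
pose bad S := (S \subset U) && (r.-1 * #|palette L S| < #|S|).
have [/existsP[S0 badS0]|/existsPn hallU] := boolP [exists S, bad S]; last first.
  apply: (colorable_hall d0) => // S sSU.
  by have := hallU S; rewrite /bad sSU -leqNgt.
have [S /maxsetP[/andP[sSU ltS] maxS] _] := maxset_exists badS0.
have [v0 v0S] : exists v, v \in S by apply/card_gt0P; apply: leq_ltn_trans ltS.
apply: (colorable_glue (X := palette L S) sSU).
- pose L' v := if v \in S then L v else L v0.
  have paletteL' : palette L' U \subset palette L S.
    by apply/bigcupsP => v _; rewrite /L'; case: ifPn => [vS|_]; apply: palette_sup.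
  have [||f [fL fgood]] := few L'.
  + by move=> v vU; rewrite /L'; case: ifP => _; apply: Lk => //; apply: (subsetP sSU).
  + apply: leq_trans (subset_leq_card sSU); apply: leq_ltn_trans ltS.
    by rewrite leq_mul2l subset_leq_card ?orbT.
  exists f; split=> [v vS|d].
    have := fL v (subsetP sSU v vS); rewrite /L' vS inE => fv.
    by rewrite fv (subsetP (palette_sup L vS)).
  have [ltr|[i fi]] := fgood d; last first.
    by right; exists i => v vS; apply: fi; apply: (subsetP sSU).
  left; apply: leq_ltn_trans ltr; apply/subset_leq_card/subsetP => v.
  by rewrite !inE => /andP[/(subsetP sSU) -> ->].
- apply: (colorable_hall d0) => // R; rewrite subsetD palette_setD => /andP[sRU disRS].
  have [->|R0] := eqVneq R set0; first by rewrite cards0.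
  (* A violation on [R] would add up with the one on [S] and make [R :|: S] a larger bad set. *)
  rewrite leqNgt; apply/negP => ltR.
  have badRS : bad (R :|: S).
    rewrite /bad subUset sRU sSU paletteU /= !cardsU (disjoint_setI0 disRS) cards0.
    have := subset_leq_card (subsetIl (palette L R) (palette L S)).
    by move: ltR; rewrite cardsD; nia.
  have eRS := maxS _ badRS (subsetUr R S).
  have /setIidPl RS : R \subset S by have := subsetUl R S; rewrite eRS.
  by case/eqP: R0; rewrite -RS (disjoint_setI0 disRS).
Qed.

(** Counts the pairs of a vertex [v] in [S] and a color of [L v] in two ways. *)
Lemma double_count k m S L : {in S, forall v, k <= #|L v|} ->
    (forall d, #|[set v in S | d \in L v]| <= m) ->
  #|S| * k <= m * #|palette L S|.
Proof.
move=> Lk Lm; rewrite -sum_nat_const.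
apply: leq_trans (_ : \sum_(v in S) \sum_(d in palette L S) (d \in L v) <= _).
  apply: leq_sum => v vS; apply: leq_trans (Lk v vS) _.
  rewrite -sum1_card big_mkcond [X in _ <= X]big_mkcond /=.
  apply: leq_sum => d _; case: ifPn => // dv.
  by rewrite (subsetP (palette_sup L vS)).
rewrite exchange_big mulnC -sum_nat_const; apply: leq_sum => d _.
apply: leq_trans (Lm d); rewrite -sum1dep_card [X in _ <= X]big_mkcondr /=.
by apply: leq_sum => v _; case: (d \in L v).
Qed.

Lemma card_parts J i0 S b : i0 \in J -> S \subset pt @^-1: J ->
    (forall i, i \in J :\ i0 -> #|S :&: pt @^-1: [set i]| <= b) ->
  #|S| <= #|S :&: pt @^-1: [set i0]| + #|J|.-1 * b.
Proof.
move=> i0J sSJ Sb.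
have -> : #|S| = \sum_(i in J) #|S :&: pt @^-1: [set i]|.
  rewrite -sum1_card (partition_big pt (mem J)) /=.
    apply: eq_bigr => i _; rewrite -sum1_card; apply: eq_bigl => v.
    by rewrite !inE.
  by move=> v /(subsetP sSJ); rewrite inE.
rewrite (big_setD1 i0) //= leq_add2l.
have -> : #|J|.-1 = #|J :\ i0| by rewrite (cardsD1 i0 J) i0J.
by rewrite -sum_nat_const; apply: leq_sum.
Qed.

Lemma colorable_step (d0 : D) k L J i0 :
    let U := pt @^-1: J in let part i := pt @^-1: [set i] in
    1 < r -> 1 < k -> #|J| = k -> i0 \in J ->
    #|part i0| = 2 * r - 1 -> {in J :\ i0, forall i, #|part i| = r} ->
    {in U, forall v, k <= #|L v|} ->
    (forall i d, i \in J :\ i0 -> exists2 v, v \in part i & d \notin L v) ->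
    r.-1 * #|palette L U| < #|U| ->
  colorable U L.
Proof.
move=> U part r1 k1 cJ i0J V1r Vr Lk nomono few.
have sVU i : i \in J -> part i \subset U.
  by move=> iJ; apply/subsetP=> v; rewrite !inE => /eqP->.
(* No color is common to all [r] lists of the part, so each color is counted at most [r.-1]
   times. *)
have full i : i \in J :\ i0 -> r * k <= r.-1 * #|palette L (part i)|.
  move=> iJ; have iJ' : i \in J by move: iJ; rewrite inE => /andP[].
  rewrite -{1}(Vr i iJ); apply: double_count => [v /(subsetP (sVU i iJ'))/Lk //|d].
  have [v vi dv] := nomono i d iJ.
  rewrite -ltnS prednK; last by lia.
  rewrite -(Vr i iJ); apply: proper_card; apply/properP; split.
    by apply/subsetP=> w; rewrite inE => /andP[].
  by exists v; rewrite // inE negb_and dv orbT.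
have [i1 i1J] : exists i, i \in J :\ i0.
  by apply/card_gt0P; have := cardsD1 i0 J; rewrite i0J; lia.
have i1J' : i1 \in J by move: i1J; rewrite inE => /andP[].
have cU : #|U| <= r * k + r.-1.
  have le_r i : i \in J :\ i0 -> #|U :&: part i| <= r.
    by move=> iJ; apply: leq_trans (subset_leq_card (subsetIr _ _)) _; rewrite Vr.
  have := card_parts i0J (subxx _) le_r; rewrite -/(part i0) -/U cJ.
  have := subset_leq_card (subsetIr U (part i0)); rewrite V1r.
  have : r * k = r + k.-1 * r by rewrite -{1}(prednK (ltnW k1)) mulnS mulnC.
  lia.
pose e := r.-1 * #|palette L U| - r * k.
have eE : r.-1 * #|palette L U| = r * k + e.
  have := full i1 i1J; have := subset_leq_card (paletteS L (sVU i1 i1J')).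
  rewrite /e; nia.
have e_le : e < r.-1 by lia.
(* Additive form of: [c] lies in at least [2 * r - 2 - e] lists of the large part. This number is at
   least [r] because [e < r.-1]. *)
have [c tc] : exists c, 2 * r <= #|[set v in part i0 | c \in L v]| + e + 2.
  apply/existsP; rewrite -[[exists _, _]]negbK; apply/negP => /existsPn few_c.
  have LkV1 : {in part i0, forall v, k <= #|L v|}.
    by move=> v /(subsetP (sVU i0 i0J))/Lk.
  have few_c' d : #|[set v in part i0 | d \in L v]| <= 2 * r - 3 - e.
    by have := few_c d; lia.
  have := double_count LkV1 few_c'; rewrite V1r; have := subset_leq_card (paletteS L (sVU i0 i0J)).
  move: eE; move: #|palette L U| #|palette L (part i0)| => n n' eE len' le1.
  have le2 : (2 * r - 1) * k * r.-1 <= (2 * r - 3 - e) * (r * k + e).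
    by rewrite -eE mulnCA mulnC leq_mul2l (leq_trans le1) ?orbT // leq_mul2l len' orbT.
  (* With [h] and [q] all truncated subtractions vanish. The left side of [le2] exceeds the right
     side by [q * (e * e + e * h + 2 * e + 1) + (e + 1) * (e + 2)], which is positive. *)
  have [h hE] : exists h, r = e + h + 2 by exists (r - (e + 2)); lia.
  have [q qE] : exists q, k = q + 2 by exists (k - 2); lia.
  have r1E : r.-1 = e + h + 1 by lia.
  have e1E : 2 * r - 3 - e = e + 2 * h + 1 by lia.
  have v1E : 2 * r - 1 = 2 * e + 2 * h + 3 by lia.
  move: le2; rewrite r1E e1E v1E hE qE.
  have := leq0n (e * e * q); have := leq0n (e * h * q); have := leq0n (e * q).
  have := leq0n (e * e); have := leq0n (e * h).
  lia.
set S0 := [set v in part i0 | c \in L v] in tc.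
have sS0 : S0 \subset part i0 by apply/subsetP=> v; rewrite inE => /andP[].
apply: (colorable_glue (S := S0) (X := [set c])).
- by apply: subset_trans sS0 (sVU i0 i0J).
- by apply: (colorable_mono (d := c) sS0) => v; rewrite !inE eqxx andbT => /andP[].
apply: (colorable_hall d0) => // S; rewrite subsetD palette_setD => /andP[sSU disS].
have cUS : #|U :\: S0| = #|U| - #|S0|.
  by rewrite cardsDS // (subset_trans sS0) ?sVU.
have leSS0 : #|S| + #|S0| <= #|U|.
  have -> : #|S| + #|S0| = #|S :|: S0|.
    by rewrite cardsU (disjoint_setI0 disS) cards0 subn0.
  by apply: subset_leq_card; rewrite subUset sSU (subset_trans sS0) ?sVU.
have cD1 : #|palette L S| <= #|palette L S :\ c|.+1.
  by rewrite (cardsD1 c (palette L S)); case: (c \in _).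
(* If [S] contains a whole part of size [r], then by [full] and [e < r.-1] the lists on [S] show
   every color. Hence at least [r * k + e - r.-1] places remain after deleting [c], and this is the
   bound on [#|U| - #|S0|] given by [cU] and [tc]. *)
have [/existsP[i /andP[iJ sPS]]|/existsPn nofull] :=
    boolP [exists i, (i \in J :\ i0) && (part i \subset S)].
  have le1 := full i iJ; have le2 := subset_leq_card (paletteS L sPS).
  have : #|palette L U| <= #|palette L S :\ c|.+1.
    by rewrite leqNgt; apply/negP; nia.
  nia.
have leS : #|S| <= #|S :&: part i0| + k.-1 * r.-1.
  rewrite -cJ; apply: card_parts => // i iJ.
  have := nofull i; rewrite iJ /= => nsub.
  rewrite -ltnS prednK; last by lia.
  rewrite -(Vr i iJ); apply: proper_card; rewrite properE subsetIr subsetI.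
  by rewrite negb_and nsub.
(* If [S] avoids the large part, it has at most [k.-1 * r.-1] vertices, and one list without [c]
   suffices. Otherwise a vertex of [S] in the large part lies outside [S0], so its list keeps all
   its colors, at least [k], while [S] has at most [r.-1] vertices in that part. *)
have [SV0|/set0Pn[v]] := eqVneq (S :&: part i0) set0.
  rewrite SV0 cards0 add0n in leS.
  have [->|[v vS]] := set_0Vmem S; first by rewrite cards0.
  have le1 := subset_leq_card (palette_sup L vS).
  have le2 := Lk v (subsetP sSU v vS).
  apply: leq_trans leS _; rewrite mulnC leq_mul2l; apply/orP; right.
  by move: cD1 le1 le2; lia.
rewrite inE => /andP[vS vi0].
have cv : c \notin L v.
  by apply/negP => cv; have := disjointFr disS vS; rewrite inE vi0 cv.
have sLv : L v \subset palette L S :\ c by rewrite subsetD1 palette_sup.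
have le1 := subset_leq_card sLv; have le2 := Lk v (subsetP sSU v vS).
have le3 : #|S :&: part i0| + #|S0| <= 2 * r - 1.
  rewrite -V1r -(cardsID S0 (part i0)) addnC (setIidPr sS0) leq_add2l.
  apply: subset_leq_card; rewrite subsetD subsetIr.
  by apply: disjointWl disS; apply: subsetIl.
apply: leq_trans leS _; apply: leq_trans (_ : r.-1 * k <= _).
  by rewrite -{2}(prednK (ltnW k1)) mulnS mulnC leq_add2r; lia.
by rewrite leq_mul2l (leq_trans le2 le1) orbT.
Qed.

Lemma colorable_multipartite (d0 : D) k L J i0 : 1 < r -> 0 < k -> #|J| = k ->
    i0 \in J -> #|pt @^-1: [set i0]| = 2 * r - 1 ->
    {in J :\ i0, forall i, #|pt @^-1: [set i]| = r} ->
    {in pt @^-1: J, forall v, k <= #|L v|} ->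
  colorable (pt @^-1: J) L.
Proof.
move=> r1; elim: k => // k IHk in L J *; move=> _ cJ i0J V1r Vr Lk.
(* Here [k] is one less than the number of parts. If only one part remains, any choice from the
   lists is good. *)
have [k0|k0] := posnP k.
  have /cards1P[i Ji] : #|J| == 1 by rewrite cJ k0.
  exists (fun v => odflt d0 [pick d in L v]); split=> [v vU|d].
    case: pickP => //= L0; have := Lk v vU.
    by rewrite (eq_card0 L0).
  by right; exists i => v; rewrite Ji !inE => /eqP.
(* This reduction replaces the lists, so it must precede the search for a common color. *)
apply: (colorable_few_colors d0 r1 _ Lk) => {Lk}L Lk few.
have [/existsP[i /existsP[d /andP[iJ dL]]]|nomono] := boolP [exists i, [exists d,
    (i \in J :\ i0) && [forall (v | v \in pt @^-1: [set i]), d \in L v]]].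
  have [iNi0 iJ'] : i != i0 /\ i \in J by move: iJ; rewrite !inE => /andP[].
  apply: (colorable_glue (S := pt @^-1: [set i]) (X := [set d])).
  - by apply: preimsetS; rewrite sub1set.
  - apply: (colorable_mono (i := i) (d := d)) => // v vi.
    by rewrite !inE eqxx andbT; apply: (forall_inP dL).
  rewrite -preimsetD; apply: IHk => //.
  - by have := cardsD1 i J; rewrite iJ' cJ; lia.
  - by rewrite !inE i0J eq_sym iNi0.
  - by move=> j; rewrite !inE => /and3P[j0 ji jJ]; apply: Vr; rewrite !inE j0.
  - move=> v; rewrite !inE => /andP[_ vJ]; have := Lk v; rewrite inE vJ => /(_ isT).
    by rewrite (cardsD1 d (L v)); case: (d \in _) => /=; lia.
apply: (colorable_step d0 (k := k.+1) (i0 := i0)) => // i d iJ.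
move/existsPn/(_ i)/existsPn/(_ d): nomono; rewrite iJ /= => /forall_inPn[v vi dv].
by exists v.
Qed.

End ListColoring.

Lemma subset_between (T : finType) (A B : {set T}) n :
  A \subset B -> #|A| <= n <= #|B| ->
  exists2 E : {set T}, #|E| = n & (A \subset E) && (E \subset B).
Proof.
move=> sAB /andP[leAn lenB].
have /card_geqP[s [us ss sD]] : n - #|A| <= #|B :\: A| by rewrite cardsDS //; lia.
have sE : [set:: s] \subset B :\: A by apply/subsetP=> x; rewrite inE => /sD.
move: (sE); rewrite subsetD => /andP[sB dA].
exists (A :|: [set:: s]); last by rewrite subsetUl subUset sAB.
rewrite cardsU setIC (disjoint_setI0 dA) cards0 subn0 cardsE (card_uniqP us) ss; lia.
Qed.

(** * Good colorings and proper colorings of complete multipartite hypergraphs *)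

Section Multipartite.
Variables (k : nat) (p : 'I_k -> nat) (r : nat).
Let T := multipartite_vertex p.

Lemma card_part (i : 'I_k) : #|part p i| = p i.
Proof.
have Tinj : injective (Tagged (fun j => 'I_(p j)) : 'I_(p i) -> T).
  by move=> x y /eqP; rewrite eq_Tagged => /eqP.
rewrite -[RHS]card_ord -cardsT -(card_imset _ Tinj); apply: eq_card => v.
rewrite inE; apply/eqP/imsetP => [|[x _ ->] //].
by case: v => j x /= ji; case: _ / ji; exists x; rewrite ?inE.
Qed.

Lemma good_proper (D : finType) (f : T -> D) :
  good (fun v : T => tag v) r [set: T] f ->
  proper_coloring (complete_multipartite p r) f.
Proof.
move=> fgood e; rewrite inE => /andP[/eqP er /forallP epart] [d ed].
have se : e \subset [set v in setT | f v == d].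
  by apply/subsetP=> v /ed <-; rewrite !inE /=.
have [|[i fi]] := fgood d; first by rewrite ltnNge -er (subset_leq_card se).
case/negP: (epart i); apply/subsetP => v ve; rewrite inE.
by apply/eqP/fi => //; apply: ed.
Qed.

(** A color class with at least [r] vertices that meets two parts contains a pair from different
    parts. As [1 < r], the pair extends within the class to a monochromatic edge. *)
Lemma proper_good (D : finType) (f : T -> D) : 1 < r ->
  proper_coloring (complete_multipartite p r) f ->
  good (fun v : T => tag v) r [set: T] f.
Proof.
move=> r1 fproper d; set A := [set v in setT | f v == d].
have [|rA] := ltnP #|A| r; [by left | right].
have /card_gt0P[u uA] : 0 < #|A| by lia.
have [/existsP[w /andP[wA uw]]|/existsPn same] :=
    boolP [exists w, (w \in A) && (tag w != tag u)].
  have sA : [set u; w] \subset A by rewrite subUset !sub1set uA.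
  have [|e er /andP[se seA]] := @subset_between _ [set u; w] A r sA.
    by rewrite rA andbT cards2; case: (_ == _); lia.
  case: (fproper e); last by exists d => v /(subsetP seA); rewrite inE => /andP[_ /eqP].
  rewrite inE er eqxx; apply/forallP => i; apply/negP => /subsetP ei.
  have := ei u (subsetP se u (set21 _ _)); have := ei w (subsetP se w (set22 _ _)).
  by rewrite !inE => /eqP wi /eqP ui; rewrite ui wi eqxx in uw.
exists (tag u) => v _ fv; by have := same v; rewrite !inE fv eqxx /= => /negPn/eqP.
Qed.

(** Carries colorings from a finite set of colors to an ambient type. With [0 < r] edges are
    nonempty, so a color in [D] on an edge comes from one in [C]. *)
Lemma proper_coloring_inj (C D : Type) (h : C -> D) (f : T -> C) :
  0 < r -> injective h ->
  proper_coloring (complete_multipartite p r) f ->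
  proper_coloring (complete_multipartite p r) (h \o f).
Proof.
move=> r0 hinj fproper e eH [d ed]; apply: (fproper e eH).
have /card_gt0P[v ve] : 0 < #|e| by move: eH; rewrite inE => /andP[/eqP-> _].
by exists (f v) => w we; apply: hinj; rewrite [RHS](ed v ve) -(ed w we).
Qed.

Lemma part_preimset (i : 'I_k) : part p i = (fun v : T => tag v) @^-1: [set i].
Proof. by apply/setP=> v; rewrite !inE. Qed.

End Multipartite.

(** * The two bounds on the list chromatic number *)

Lemma choosable_multipartite r k : 1 < r -> 0 < k ->
  choosable (complete_multipartite (@part_sizes r k) r) k.
Proof.
move=> r1 k0 C L Lk; set p := @part_sizes r k in L Lk *.
set T := multipartite_vertex p in L Lk *.
pose i0 : 'I_k := Ordinal k0.
(* The colors that occur in lists form a finite type, as the Hall arguments require. *)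
pose F := (\bigcup_(v <- enum T) L v)%fset.
have LF v : (L v `<=` F)%fset by apply: bigfcup_sup; rewrite ?mem_enum.
have cV i : #|(fun v : T => tag v) @^-1: [set i]| = p i.
  by rewrite -part_preimset card_part.
have /card_gt0P[v0 _] : 0 < #|(fun v : T => tag v) @^-1: [set i0]|.
  by rewrite cV /p /part_sizes /=; lia.
have /fset0Pn[d0 d0L] : L v0 != fset0 by rewrite -cardfs_gt0 Lk.
pose d0F : F := [` fsubsetP (LF v0) d0 d0L]%fset.
have [|||||f [fL fgood]] := @colorable_multipartite T F _ (fun v : T => tag v) r d0F k
  (fun v => fsub F (L v)) setT i0 r1 k0.
- by rewrite cardsT card_ord.
- by rewrite inE.
- exact: (cV i0).
- move=> i; rewrite !inE andbT => ii0; rewrite [LHS](cV i) /p /part_sizes.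
  by case: ifPn => // /eqP i00; case/eqP: ii0; apply: val_inj.
- by move=> v _; rewrite card_fsub // Lk.
rewrite preimsetT in fL fgood; exists (fun v => val (f v)); split=> [|v].
  by apply: (proper_coloring_inj (ltnW r1) val_inj); apply: good_proper.
by have := fL v (in_setT _); rewrite in_fsub.
Qed.

(* The colors of a proper coloring cover at most r vertices each outside the
   largest part, and a color occurring in the largest part covers fewer than r. *)
Lemma leq_choosable r k j : 1 < r -> 0 < k ->
  choosable (complete_multipartite (@part_sizes r k) r) j -> k <= j.
Proof.
move=> r1 k0; set p := @part_sizes r k; set T := multipartite_vertex p.
pose i0 : 'I_k := Ordinal k0.
(* Identical lists of all [j] colors reduce the bound to ordinary colorings. *)
move=> /(_ 'I_j (fun=> [fset x in 'I_j]%fset))[|c [/(proper_good r1) cgood _]].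
  by move=> v; rewrite card_finset card_ord.
have cV i : #|part p i| = p i by rewrite card_part.
have /card_gt0P[v0] : 0 < #|part p i0| by rewrite cV /p /part_sizes /=; lia.
rewrite inE => /eqP v0i0.
pose W : {set T} := ~: part p i0.
have pr i : i != i0 -> p i = r.
  by rewrite /p /part_sizes; case: ifP => // /eqP ii0 /eqP[]; apply: val_inj.
have cW : #|W| = k.-1 * r.
  rewrite -sum1_card (partition_big (fun v : T => tag v) (predC1 i0)) /=; last first.
    by move=> v; rewrite !inE.
  have -> : k.-1 = #|predC1 i0| by rewrite cardC1 card_ord.
  rewrite -sum_nat_const; apply: eq_bigr => i ii0; rewrite -(pr i ii0) -cV -sum1_card.
  by apply: eq_bigl => v; rewrite !inE; case: (eqVneq (tag v) i) => [->|_];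
    rewrite ?andbF // andbT.
have le_r a : #|[set v in W | c v == a]| <= r.
  have [ltr|[i ci]] := cgood a.
    apply: leq_trans (ltnW ltr); apply/subset_leq_card/subsetP => v.
    by rewrite !inE => /andP[].
  have [->|[v]] := set_0Vmem [set v in W | c v == a]; first by rewrite cards0.
  rewrite !inE => /andP[vi0 /eqP va]; rewrite (ci v (in_setT _) va) in vi0.
  rewrite -(pr i vi0) -cV; apply/subset_leq_card/subsetP => w.
  by rewrite !inE => /andP[_ /eqP wa]; rewrite (ci w).
have lt_r : #|[set v in W | c v == c v0]| < r.
  have [|[i ci]] := cgood (c v0).
    apply: leq_ltn_trans; apply/subset_leq_card/subsetP => v.
    by rewrite !inE => /andP[].
  rewrite (_ : [set v in W | _] = set0) ?cards0 ?(ltnW r1) //.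
  apply/setP=> v; rewrite !inE; apply/negP => /andP[vi0 /eqP /(ci v (in_setT _)) vi].
  by case/negP: vi0; rewrite vi -(ci v0) // v0i0.
(* The color of [v0] contributes at most [r.-1] vertices, each of the other [j.-1] colors at most
   [r]. *)
have leW : #|W| <= r.-1 + j.-1 * r.
  rewrite -sum1_card (partition_big c predT) //= (bigD1 (c v0)) //=.
  apply: leq_add; first by rewrite -ltnS prednK ?(ltnW r1) // sum1dep_card.
  have -> : j.-1 = #|predC1 (c v0)| by rewrite cardC1 card_ord.
  rewrite -sum_nat_const; apply: leq_sum => a _.
  by rewrite sum1dep_card.
have j0 : 0 < j by apply: leq_ltn_trans (ltn_ord (c v0)).
rewrite leqNgt; apply/negP => jk; move: leW; rewrite cW.
have : j.-1.+1 * r <= k.-1 * r by rewrite leq_mul2r; lia.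
rewrite mulSn; lia.
Qed.

Theorem theorem4p5 (r k : nat) (hr : 2 <= r) (hk : 1 <= k) :
  list_chromatic_number_is (complete_multipartite (@part_sizes r k) r) k.
Proof. by split=> [|j]; [apply: choosable_multipartite | apply: leq_choosable]. Qed.
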